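(* Let $S=K[x_1,\dots,x_n]$ be a polynomial ring of dimension $n\geq 2$ over a field $K$, and let $Z_{n-1}=\operatorname{Im}\partial_{n-1}$, where $\partial_\bullet$ is the differential of the Koszul complex on $x_1,\dots,x_n$. For all $1\leq i<j\leq n$, the ideal $(x_i,x_j)$ is a Bourbaki ideal of $Z_{n-1}$.
   Context: The Koszul complex on $x_1,\dots,x_n$ is $0\to K_n\xrightarrow{\partial_n}K_{n-1}\to\cdots\to K_1\xrightarrow{\partial_1}K_0=S$, with $K_j=\bigwedge^j S^n$ and $\partial(\mathbf e_{i_1\dots i_j})=\sum_{k=1}^{j}(-1)^{k+1}x_{i_k}\mathbf e_{i_1\dots\widehat{i_k}\dots i_j}$. An ideal $I$ of $S$ is a Bourbaki ideal of a finitely generated $S$-module $M$ if there is a short exact sequence $0\to F\to M\to I\to 0$ of $S$-modules (a Bourbaki sequence) with $F$ free. *)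

(* Defs.v *)
From HB Require Import structures.
From mathcomp Require Import all_boot all_order all_algebra.
From mathcomp Require Import boolp.
From mathcomp Require Export mpoly.

Set Implicit Arguments.
Unset Strict Implicit.
Unset Printing Implicit Defensive.

Import GRing.Theory.

Local Open Scope ring_scope.

(* A submodule [P] as a module in its own right. *)
Section SubmodType.
Variables (R : comNzRingType) (V : lmodType R) (P : submodClosed V).

Record submod_type : Type := Submod { submod_val : V; _ : submod_val \in P }.

HB.instance Definition _ := [isSub for submod_val].
HB.instance Definition _ := [Choice of submod_type by <:].
HB.instance Definition _ := [SubChoice_isSubLmodule of submod_type by <:].

End SubmodType.

Section Submodules.
Variables (R : comNzRingType) (V : lmodType R).

Section Span.
Variable s : seq V.

Definition lspan : {pred V} :=
  fun v => `[< exists c : nat -> R, v = \sum_(k < size s) c k *: s`_k >].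

Lemma lspan_submod_closed : submod_closed lspan.
Proof.
split=> [|a u v /asboolP[c ->] /asboolP[d ->]]; apply/asboolP.
  by exists (fun=> 0); rewrite big1 // => k _; rewrite scale0r.
exists (fun k => a * c k + d k); rewrite scaler_sumr -big_split /=.
by apply: eq_bigr => k _; rewrite scalerDl scalerA.
Qed.

HB.instance Definition _ :=
  GRing.isSubmodClosed.Build R V lspan lspan_submod_closed.

End Span.

Section Image.
Variables (U : lmodType R) (f : {linear U -> V}).

Definition limage : {pred V} := fun v => `[< exists u : U, v = f u >].

Lemma limage_submod_closed : submod_closed limage.
Proof.
split=> [|a u v /asboolP[c ->] /asboolP[d ->]]; apply/asboolP.
  by exists 0; rewrite linear0.
by exists (a *: c + d); rewrite linearP.
Qed.

HB.instance Definition _ :=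
  GRing.isSubmodClosed.Build R V limage limage_submod_closed.

End Image.

Definition finitely_generated : Prop :=
  exists s : seq V, forall v : V, v \in lspan s.

Definition is_basis (J : choiceType) (b : J -> V) : Prop :=
  (forall v : V, exists (s : seq J) (c : J -> R), v = \sum_(k <- s) c k *: b k)
  /\ (forall (s : seq J) (c : J -> R),
        uniq s -> \sum_(k <- s) c k *: b k = 0 -> forall k, k \in s -> c k = 0).

Definition free_module : Prop :=
  exists (J : choiceType) (b : J -> V), is_basis b.

End Submodules.

Definition short_exact (R : comNzRingType) (A B C : lmodType R)
    (f : {linear A -> B}) (g : {linear B -> C}) : Prop :=
  [/\ injective f,
      forall b : B, g b = 0 <-> exists a : A, b = f a
    & forall c : C, exists b : B, g b = c].

(* Ideals of [R] are the submodules of the regular module [R^o]. *)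
Definition bourbaki_ideal (R : comNzRingType) (M : lmodType R)
    (I : submodClosed R^o) : Prop :=
  finitely_generated M /\
  exists (F : lmodType R) (f : {linear F -> M})
         (g : {linear M -> submod_type I}),
    free_module F /\ short_exact f g.

Section Koszul.
Variables (R : comNzRingType) (n : nat) (x : 'I_n -> R).

(* The exterior power of degree [j] of [R^n], as the free module whose basis
   element e_{i_1 ... i_j}, i_1 < ... < i_j, is indexed by the set
   {i_1, ..., i_j}. *)
Definition koszul (j : nat) : lmodType R :=
  {ffun {A : {set 'I_n} | #|A| == j} -> R^o}.

(* This is [0] when [#|B| != j]. *)
Definition koszul_basis (j : nat) (B : {set 'I_n}) : koszul j :=
  [ffun A => (val A == B)%:R].

(* In the increasing enumeration i_1 < ... < i_j of [A], the number of elements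
   of [A] below i_k is k - 1, which has the parity of k + 1. *)
Definition koszul_diff_basis (j : nat) (A : {set 'I_n}) : koszul j.-1 :=
  \sum_(i in A)
     ((-1) ^+ #|[set l in A | (l < i)%N]| * x i) *: koszul_basis j.-1 (A :\ i).

(* For [j = 0] this is the zero endomorphism of [koszul 0]. *)
Definition koszul_diff (j : nat) (c : koszul j) : koszul j.-1 :=
  \sum_A (c A : R) *: koszul_diff_basis j (val A).

Lemma koszul_diff_linear (j : nat) : linear (@koszul_diff j).
Proof.
move=> a u v; rewrite /koszul_diff scaler_sumr -big_split /=.
by apply: eq_bigr => A _; rewrite !ffunE scalerDl scalerA.
Qed.

HB.instance Definition _ (j : nat) :=
  GRing.isLinear.Build R (koszul j) (koszul j.-1) *:%R (@koszul_diff j)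
    (@koszul_diff_linear j).

End Koszul.

Section KoszulPolynomial.
Variables (K : fieldType) (n : nat).

Definition koszul_boundaries (j : nat) : submodClosed (koszul _ n j.-1) :=
  limage (@koszul_diff {mpoly K[n]} n (fun i => 'X_i) j).

Definition ideal_of_vars (i j : 'I_n) : submodClosed {mpoly K[n]}^o :=
  lspan ([:: 'X_i; 'X_j] : seq {mpoly K[n]}^o).

End KoszulPolynomial.

(* Main.v *)
Require Import Defs.
From HB Require Import structures.
From mathcomp Require Import all_boot all_order all_algebra.
From mathcomp Require Import boolp zify ring.

(** The complement map identifies K_{n-1} with S^n, the basis element indexed by
    the complement of {k} becoming the k-th unit vector, and K_{n-2} with the
    second exterior power of S^n.  Put y_k = (-1)^k x_k.  Under these
    identifications the differential is, up to the sign of each coordinate,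
    the wedge product with y: the coordinate of the boundary of c at the
    complement of {k, l} is y_l c_k - y_k c_l ([koszul_diff_coord]).

    The Bourbaki sequence comes from projecting Z_{n-1} to its single coordinate
    at the complement of {i, j}.  As c varies, y_j c_i - y_i c_j takes all
    values in (x_i, x_j) and no others.  It vanishes only if
    (c_i, c_j) = d (y_i, y_j) for some d, because x_i, x_j is a regular
    sequence.  Since y wedge y = 0 ([koszul_diff_eq0]), replacing c by c - d y
    does not change the boundary of c, and this makes the entries of c at i and
    j vanish.  The kernel is therefore spanned by the boundaries of the unit
    vectors other than the i-th and j-th.  These are linearly independent: if
    c_i = 0 and the boundary of c vanishes, its coordinate at the complement of
    {i, k} gives y_i c_k = 0.

    This runs over any integral domain in which x_i, x_j is a regular sequence
    ([bourbaki_ideal_koszul_boundaries]); for variables of a polynomial ring,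
    regularity is read off the monomials ([mpolyX_regular]). *)

Set Implicit Arguments.
Unset Strict Implicit.
Unset Printing Implicit Defensive.

Import GRing.Theory.

Local Open Scope ring_scope.

(** * Linear maps, spans and free modules *)

Section LinearMaps.
Variables (R : comNzRingType) (U V : lmodType R).

Section Corestriction.
Variables (P : submodClosed V) (h : {linear U -> V}).
Hypothesis hP : forall u, h u \in P.

Definition corestrict (u : U) : submod_type P := Submod (hP u).

Lemma corestrict_linear : linear corestrict.
Proof. by move=> a u v; apply: val_inj; rewrite /= linearP. Qed.

HB.instance Definition _ :=
  GRing.isLinear.Build R U (submod_type P) *:%R corestrict corestrict_linear.

End Corestriction.

Lemma limageP (f : {linear U -> V}) (v : V) :
  reflect (exists u, v = f u) (v \in limage f).
Proof. exact: asboolP. Qed.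

Lemma mem_limage (f : {linear U -> V}) (u : U) : f u \in limage f.
Proof. by apply/limageP; exists u. Qed.

Lemma mem_lspan (s : seq V) (v : V) : v \in s -> v \in lspan s.
Proof.
move=> vs; apply/asboolP; exists (fun k => (k == index v s)%:R).
have vi : (index v s < size s)%N by rewrite index_mem.
rewrite (bigD1 (Ordinal vi)) //= eqxx scale1r nth_index // big1 ?addr0 // => k.
by rewrite -val_eqE => /negPf /= ->; rewrite scale0r.
Qed.

Lemma lspan2P (a b v : V) :
  reflect (exists c d, v = c *: a + d *: b) (v \in lspan [:: a; b]).
Proof.
apply: (iffP idP) => [/asboolP[c ->]|[c [d ->]]].
  by exists (c 0%N), (c 1%N); rewrite !big_ord_recl big_ord0 addr0.
by apply: rpredD; apply: rpredZ; apply: mem_lspan; rewrite !inE eqxx ?orbT.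
Qed.

Lemma finitely_generated_surj (g : {linear U -> V}) :
  (forall v, exists u, g u = v) -> finitely_generated U -> finitely_generated V.
Proof.
move=> gsurj [s sP]; exists (map g s) => v.
have [u <-] := gsurj v; have /asboolP[c ->] := sP u.
rewrite linear_sum; apply: rpred_sum => k _; rewrite linearZ.
by apply: rpredZ; apply/mem_lspan/map_f/mem_nth.
Qed.

End LinearMaps.

Section FiniteFunctions.
Variables (R : comNzRingType) (J : finType).

Definition ffun_coord (k : J) (b : {ffun J -> R^o}) : R^o := b k.

Lemma ffun_coord_linear k : linear (ffun_coord k).
Proof. by move=> a u v; rewrite /ffun_coord !ffunE. Qed.

HB.instance Definition _ k :=
  GRing.isLinear.Build R {ffun J -> R^o} R^o *:%R (ffun_coord k)
    (ffun_coord_linear k).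

Definition ffun_delta (k : J) : {ffun J -> R^o} := [ffun l => (l == k)%:R].

Lemma ffun_sum_delta (b : {ffun J -> R^o}) :
  b = \sum_k (b k : R) *: ffun_delta k.
Proof.
apply/ffunP => l; rewrite sum_ffunE (bigD1 l) //= !ffunE eqxx.
rewrite big1 ?addr0 => [|k /negPf lk]; first by rewrite [RHS]mulr1.
by rewrite !ffunE eq_sym lk scaler0.
Qed.

Lemma ffun_finitely_generated : finitely_generated {ffun J -> R^o}.
Proof.
exists (map ffun_delta (enum J)) => b; rewrite [b]ffun_sum_delta.
apply: rpred_sum => k _; apply: rpredZ.
by apply/mem_lspan/map_f; rewrite mem_enum.
Qed.

Lemma ffun_free : free_module {ffun J -> R^o}.
Proof.
exists J, ffun_delta; split=> [b | s c us sum0 k ks].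
  by exists (index_enum J), b; exact: ffun_sum_delta.
have := congr1 (fun b : {ffun J -> R^o} => b k) sum0.
rewrite sum_ffunE (bigD1_seq k) //= big1 => [|l /negPf lk].
  by rewrite !ffunE eqxx addr0 => <-; rewrite [RHS]mulr1.
by rewrite !ffunE eq_sym lk scaler0.
Qed.

Variables (V : lmodType R) (e : J -> V).

Definition lincomb (b : {ffun J -> R^o}) : V := \sum_k (b k : R) *: e k.

Lemma lincomb_linear : linear lincomb.
Proof.
move=> a u v; rewrite /lincomb scaler_sumr -big_split /=.
by apply: eq_bigr => k _; rewrite !ffunE scalerDl scalerA.
Qed.

HB.instance Definition _ :=
  GRing.isLinear.Build R {ffun J -> R^o} V *:%R lincomb lincomb_linear.

End FiniteFunctions.

(** * The differential in codegree one *)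

Section Codegree1.
Variables (R : comNzRingType) (n : nat) (x : 'I_n -> R).

Lemma card_setC1 (k : 'I_n) : #|~: [set k]| == n.-1.
Proof. by rewrite cardsC1 card_ord. Qed.

Definition cofacet (k : 'I_n) : {A : {set 'I_n} | #|A| == n.-1} :=
  Sub (~: [set k]) (card_setC1 k).

Lemma cofacet_inj : injective cofacet.
Proof. by move=> k l /(congr1 val) /setC_inj /set1_inj. Qed.

Lemma cofacet_bij : (0 < n)%N -> bijective cofacet.
Proof.
move=> n_gt0; apply: (inj_card_bij cofacet_inj).
rewrite card_sig card_ord -[X in (_ <= X)%N](card_ord n).
rewrite (eq_card (B := [set A : {set 'I_n} | #|A| == n.-1])); last first.
  by move=> A; rewrite !inE.
rewrite card_draws !card_ord; case: n n_gt0 => // m _ /=.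
by rewrite -bin_sub // subSnn bin1.
Qed.

Lemma card_setC2 (k l : 'I_n) : k != l -> #|~: [set k; l]| == n.-1.-1.
Proof.
by move=> kl; rewrite cardsCs setCK cards2 kl card_ord -subn2; apply/eqP; lia.
Qed.

Definition cofacet2 (k l : 'I_n) (kl : k != l) :
    {A : {set 'I_n} | #|A| == n.-1.-1} :=
  Sub (~: [set k; l]) (card_setC2 kl).

Lemma setC2_of_card (B : {set 'I_n}) :
  (2 <= n)%N -> #|B| == n.-1.-1 -> exists k l, k != l /\ B = ~: [set k; l].
Proof.
move=> n_ge2 /eqP cardB.
have /cards2P[k [l [kl BC]]] : #|~: B| == 2.
  by rewrite cardsCs setCK cardB card_ord; apply/eqP; lia.
by exists k, l; split=> //; rewrite -BC setCK.
Qed.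

Definition koszul_cocoord (c : koszul R n n.-1) (k : 'I_n) : R :=
  c (cofacet k).

Lemma koszul_cocoordB c1 c2 k :
  koszul_cocoord (c1 - c2) k = koszul_cocoord c1 k - koszul_cocoord c2 k.
Proof. by rewrite /koszul_cocoord !ffunE. Qed.

Lemma koszul_cocoord_basis k l :
  koszul_cocoord (koszul_basis R n.-1 (~: [set l])) k = (k == l)%:R.
Proof.
rewrite /koszul_cocoord ffunE; congr _%:R.
by rewrite (inj_eq (@setC_inj _)) (inj_eq (@set1_inj _)).
Qed.

Definition signed_seq (k : 'I_n) : R := (-1) ^+ k * x k.

Local Notation y := signed_seq.

(** The sign of x_l counts the l' < l other than k: there are l of them if
    l < k, and l - 1 if k < l. *)
Lemma koszul_diff_basis_coord (k l : 'I_n)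
    (B : {A : {set 'I_n} | #|A| == n.-1.-1}) :
  k != l -> val B = ~: [set k; l] ->
  koszul_diff_basis x n.-1 (~: [set k]) B = (-1) ^+ (k < l)%N * y l.
Proof.
move=> kl BE; rewrite /koszul_diff_basis sum_ffunE (bigD1 l) /=; last first.
  by rewrite !inE eq_sym.
rewrite big1 => [|m /andP[_ ml]]; last first.
  rewrite !ffunE BE; case: eqP => [E|_]; last by rewrite scaler0.
  by have /setP/(_ l) := E; rewrite !inE eqxx orbT eq_sym ml eq_sym kl.
rewrite addr0 !ffunE BE setDE -setCU eqxx [LHS]mulr1 /y mulrA -exprD; congr (_ * _).
rewrite -signr_odd -[RHS]signr_odd; congr ((-1) ^+ nat_of_bool _).
have cardl : #|[set m : 'I_n | (m < l)%N]| = l.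
  rewrite -sum1dep_card -(big_ord_widen_cond n xpredT (fun=> 1%N)).
    by rewrite sum1_card card_ord.
  exact: ltnW.
move: cardl; rewrite (cardsD1 k) inE.
rewrite (_ : _ :\ k = [set m in ~: [set k] | (m < l)%N]).
  by move=> /(congr1 odd); rewrite !oddD !oddb => <-; rewrite addbA addbb.
by apply/setP => m; rewrite !inE.
Qed.

(** Self-duality of the Koszul complex in degrees n-1 and n-2: the differential
    is c |-> c wedge y, up to the sign of each coordinate. *)
Lemma koszul_diff_coord (c : koszul R n n.-1) (k l : 'I_n)
    (B : {A : {set 'I_n} | #|A| == n.-1.-1}) :
  k != l -> val B = ~: [set k; l] ->
  koszul_diff x c B =
  (-1) ^+ (k < l)%N * (y l * koszul_cocoord c k - y k * koszul_cocoord c l).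
Proof.
move=> kl BE; have n_gt0 : (0 < n)%N by apply: leq_ltn_trans (ltn_ord k).
rewrite /koszul_diff sum_ffunE (reindex cofacet) /=; last first.
  exact/onW_bij/cofacet_bij.
rewrite (bigD1 k) //= (bigD1 l) 1?eq_sym //= big1 => [|m /andP[mk ml]]; last first.
  (* m lies in B, hence in no face of the complement of m *)
  rewrite ffunE /koszul_diff_basis sum_ffunE big1 ?scaler0 // => h _.
  rewrite !ffunE BE; case: eqP => [E|_]; last by rewrite scaler0.
  by have /setP/(_ m) := E; rewrite !inE eqxx (negPf mk) (negPf ml) andbF.
rewrite addr0 !ffunE (koszul_diff_basis_coord kl BE).
rewrite (@koszul_diff_basis_coord l k) 1?eq_sym //; last by rewrite setUC.
have -> : (-1) ^+ (l < k)%N = - (-1) ^+ (k < l)%N :> R.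
  by move: kl; rewrite -val_eqE /=; case: ltngtP => // _ _; rewrite expr0 expr1 ?opprK.
rewrite mulrBr /koszul_cocoord; congr (_ + _).
  exact: etrans (mulrC _ _) (esym (mulrA _ _ _)).
rewrite mulNr [LHS]mulrN; congr (- _).
exact: etrans (mulrC _ _) (esym (mulrA _ _ _)).
Qed.

(** This is d (y wedge y) = 0, which on coordinates is commutativity:
    y_l y_k d - y_k y_l d = 0. *)
Lemma koszul_diff_eq0 (c : koszul R n n.-1) (d : R) :
  (2 <= n)%N -> (forall k, koszul_cocoord c k = y k * d) -> koszul_diff x c = 0.
Proof.
move=> n_ge2 cE; apply/ffunP => B; rewrite ffunE.
have [k [l [kl BE]]] := setC2_of_card n_ge2 (valP B).
by rewrite (koszul_diff_coord _ kl BE) !cE mulrCA subrr mulr0.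
Qed.

End Codegree1.

(** * The Bourbaki sequence of a regular pair *)

Section RegularPair.
Variables (R : idomainType) (n : nat) (x : 'I_n -> R) (i j : 'I_n).
Hypotheses (n_ge2 : (2 <= n)%N) (ij : i != j) (xi0 : x i != 0).
Hypothesis x_reg : forall a b, x j * a = x i * b -> exists d, a = x i * d.

Local Notation y := (signed_seq x).
Local Notation diff := (@koszul_diff R n x n.-1).
Local Notation Z := (limage diff).
Local Notation I := (lspan ([:: x i; x j] : seq R^o)).

Lemma signed_seq_neq0 : y i != 0.
Proof. by rewrite mulf_neq0 ?signr_eq0. Qed.

(** Changing the signs of x_i and x_j preserves regularity; b is then recovered
    by cancelling the nonzero factor y_i. *)
Lemma signed_seq_regular a b :
  y j * a = y i * b -> exists d, a = y i * d /\ b = y j * d.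
Proof.
move=> E.
have [d aE] : exists d, a = x i * d.
  apply: (@x_reg a ((-1) ^+ j * (-1) ^+ i * b)).
  move: E; rewrite /signed_seq -!mulrA => /(congr1 ( *%R ((-1) ^+ j))).
  rewrite signrMK => ->.
  by rewrite [x i * (_ * _)]mulrCA [x i * (_ * _)]mulrCA.
have {}aE : a = y i * ((-1) ^+ i * d).
  by rewrite /signed_seq mulrAC signrMK mulrC.
exists ((-1) ^+ i * d); split=> //.
by apply: (mulfI signed_seq_neq0); rewrite -E aE mulrCA.
Qed.

Local Notation J := {k : 'I_n | (k != i) && (k != j)}.

Definition kernel_gen (k : J) : koszul R n n.-1 :=
  koszul_basis R n.-1 (~: [set val k]).

Lemma cocoord_lincomb (b : {ffun J -> R^o}) k :
  koszul_cocoord (lincomb kernel_gen b) k = oapp b 0 (insub k).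
Proof.
have E l : koszul_cocoord (lincomb kernel_gen b) l
    = \sum_h b h * (l == val h)%:R.
  rewrite /koszul_cocoord sum_ffunE; apply: eq_bigr => h _.
  by rewrite ffunE -koszul_cocoord_basis.
rewrite {}E; case: insubP => [h _ <-|kJ] /=.
  rewrite (bigD1 h) //= eqxx mulr1 big1 ?addr0 // => h' /negPf hh'.
  by rewrite val_eqE eq_sym hh' mulr0.
rewrite big1 // => h _; case: eqP => [E|_]; last by rewrite mulr0.
by rewrite E (valP h) in kJ.
Qed.

Local Notation Bij := (cofacet2 ij).

Lemma koszul_diff_coord_ij c : diff c Bij =
  (-1) ^+ (i < j)%N * (y j * koszul_cocoord c i - y i * koszul_cocoord c j).
Proof. exact: koszul_diff_coord. Qed.

(** A coordinate of Z is automatically compatible with the relation among the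
    generators of Z; what remains is to locate its values. *)
Lemma projection_in_ideal (z : submod_type Z) :
  (ffun_coord Bij \o val) z \in I.
Proof.
have /limageP[c /= zE] := valP z; rewrite /ffun_coord /= zE koszul_diff_coord_ij.
apply/lspan2P.
exists (- ((-1) ^+ (i < j)%N * ((-1) ^+ i * koszul_cocoord c j))).
exists ((-1) ^+ (i < j)%N * ((-1) ^+ j * koszul_cocoord c i)).
rewrite /signed_seq; move: ((-1) ^+ (i < j)%N) ((-1) ^+ i) ((-1) ^+ j) => s si sj.
move: (koszul_cocoord c i) (koszul_cocoord c j) => ci cj.
rewrite -[RHS]/(- (s * (si * cj)) * x i + s * (sj * ci) * x j : R).
by ring.
Qed.

Definition bourbaki_map := corestrict projection_in_ideal.

Lemma boundary_of_kernel (b : {ffun J -> R^o}) :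
  (diff \o lincomb kernel_gen) b \in Z.
Proof. exact: mem_limage. Qed.

Definition kernel_map := corestrict boundary_of_kernel.

Lemma kernel_map_inj : injective kernel_map.
Proof.
apply: raddf_inj => b /(congr1 val) /= b0; apply/ffunP => k; rewrite ffunE.
have /andP[ki kj] := valP k; have ik : i != val k by rewrite eq_sym.
(* at {i, k} the minor is y_i b_k up to sign, since the i-th entry vanishes *)
have := congr1 (fun v : koszul R n n.-1.-1 => v (cofacet2 ik)) b0.
rewrite (koszul_diff_coord _ _ ik) // ffunE !cocoord_lincomb valK /=.
rewrite insubF ?eqxx //= mulr0 sub0r => /eqP.
by rewrite mulf_eq0 signr_eq0 /= oppr_eq0 mulf_eq0 (negPf signed_seq_neq0) => /eqP.
Qed.

Lemma bourbaki_map_surj (a : submod_type I) : exists z, bourbaki_map z = a.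
Proof.
have /lspan2P[c [d aE]] := valP a.
(* the entries of u carry the signs that cancel those of the coordinate formula *)
pose s : R := (-1) ^+ (i < j)%N.
pose u : koszul R n n.-1 :=
  (s * ((-1) ^+ j * d)) *: koszul_basis R n.-1 (~: [set i])
  - (s * ((-1) ^+ i * c)) *: koszul_basis R n.-1 (~: [set j]).
exists (Submod (mem_limage diff u)); apply: val_inj.
rewrite [val a]aE /= /ffun_coord /= koszul_diff_coord_ij /u !koszul_cocoordB.
have cocoordZ t l k :
    koszul_cocoord (t *: koszul_basis R n.-1 (~: [set l])) k = t * (k == l)%:R.
  by rewrite -koszul_cocoord_basis /koszul_cocoord ffunE.
rewrite !cocoordZ !eqxx (eq_sym j i) (negPf ij) !mulr0 !mulr1 subr0 sub0r.
rewrite -/s /signed_seq -[RHS]/(c * x i + d * x j : R).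
have signr2 t : (-1) ^+ t * (-1) ^+ t = 1 :> R by rewrite -expr2 sqrr_sign.
have := (signr2 (i < j)%N, signr2 i, signr2 j); rewrite -/s.
clear u; move: s ((-1) ^+ i) ((-1) ^+ j) => t ti tj [[t2 ti2] tj2].
transitivity (t * t * (ti * ti * (c * x i) + tj * tj * (d * x j))).
  by ring.
by rewrite t2 ti2 tj2 !mul1r.
Qed.

Lemma bourbaki_map_exact (z : submod_type Z) :
  bourbaki_map z = 0 <-> exists b, z = kernel_map b.
Proof.
split=> [/(congr1 val) /= |[b ->]]; last first.
  apply: val_inj; rewrite /= /ffun_coord /= koszul_diff_coord_ij !cocoord_lincomb.
  by rewrite !insubF ?eqxx ?andbF //= !mulr0 subrr mulr0.
have /limageP[c zE] := valP z.
rewrite /ffun_coord /= [submod_val z]zE koszul_diff_coord_ij => /eqP.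
rewrite mulf_eq0 signr_eq0 subr_eq0 /= => /eqP /signed_seq_regular[d [ciE cjE]].
(* the entries of c - d y, which vanish at i and j *)
exists [ffun k => koszul_cocoord c (val k) - y (val k) * d].
apply: val_inj; rewrite [LHS]zE; apply/eqP; rewrite -subr_eq0 /= -linearB.
apply/eqP/(@koszul_diff_eq0 _ _ _ _ d) => // k.
rewrite koszul_cocoordB cocoord_lincomb; case: insubP => [h _ <-|] /=.
  by rewrite ffunE opprB addrCA subrr addr0.
by rewrite subr0 negb_and !negbK => /orP[] /eqP ->.
Qed.

Lemma bourbaki_ideal_koszul_boundaries : bourbaki_ideal (submod_type Z) I.
Proof.
split.
  apply: (finitely_generated_surj (g := corestrict (mem_limage diff))).
    move=> z; have /limageP[c zE] := valP z.
    by exists c; apply: val_inj; rewrite [RHS]zE.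
  exact: ffun_finitely_generated.
exists {ffun J -> R^o}, kernel_map, bourbaki_map; split; first exact: ffun_free.
split; [exact: kernel_map_inj | exact: bourbaki_map_exact |].
exact: bourbaki_map_surj.
Qed.

End RegularPair.

(** * Variables of a polynomial ring *)

(** If x_i divides x_j a, then x_i divides every monomial of x_j a, hence every
    monomial of a. *)
Lemma mpolyX_regular (R : comNzRingType) (n : nat) (i j : 'I_n)
    (a b : {mpoly R[n]}) :
  i != j -> 'X_j * a = 'X_i * b -> exists d, a = 'X_i * d.
Proof.
move=> ij E; exists (\sum_(m <- msupp a) a@_m *: 'X_[m - U_(i)]).
rewrite {1}[a]mpolyE mulr_sumr; apply: eq_big_seq => m ma.
rewrite -scalerAr -mpolyXD addmC submK //.
have : (U_(j) + m)%MM \in msupp (b * 'X_i).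
  by rewrite mulrC -E mulrC (perm_mem (msuppMX _ _)); apply: map_f.
rewrite (perm_mem (msuppMX _ _)) => /mapP[m' _ /mnmP/(_ i)].
rewrite !mnmDE !mnm1E eqxx (eq_sym j) (negPf ij) add0n => mi.
by apply/mnm_lepP => k; rewrite mnm1E; case: eqP => // <-; rewrite mi.
Qed.

Theorem proposition5p2 (K : fieldType) (n : nat) (hn : (2 <= n)%N)
    (i j : 'I_n) (hij : (i < j)%N) :
  bourbaki_ideal (submod_type (koszul_boundaries K n n.-1))
    (ideal_of_vars K i j).
Proof.
have ij : i != j by rewrite neq_ltn hij.
apply: (@bourbaki_ideal_koszul_boundaries {mpoly K[n]} n) => //.
  by rewrite -msupp_eq0 msuppX.
by move=> a b; exact: mpolyX_regular.
Qed.
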